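(* Let $k,m$ be positive integers with $k<m<2k$, and for $n,r\ge 0$ let $b_k(m,n,r)$ denote the number of tilings of an $m\times n$ rectangle with $k\times 1$ tiles which contain precisely $r$ vertical tiles. Then, as formal power series in $x,y$, $$\sum_{n,r\geq 0}b_k(m,n,r)x^ny^r=\frac{(1-x^k)^{k-1}}{(1-x^k)^k-(m-k+1)x^ky^k}.$$
   Context: The $m\times n$ rectangle is placed with its bottom left corner at the origin, with a side of length $m$ along the $y$-axis and a side of length $n$ along the $x$-axis, and is divided into unit cells. A tiling with $k\times 1$ tiles is a partition of the cells of the rectangle into tiles, each of which is either a horizontal row of $k$ consecutive cells (a horizontal tile, extending parallel to the $x$-axis) or a vertical column of $k$ consecutive cells (a vertical tile, extending parallel to the $y$-axis); both orientations are allowed. Tilings are counted as distinct configurations (not up to symmetry). Convention: for $n=0$ there is exactly one tiling, the empty one, which contains no tiles. *)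

(* Defs.v *)
From HB Require Import structures.
From mathcomp Require Import all_boot all_order all_algebra.
From mathcomp Require Import boolp.

Set Implicit Arguments.
Unset Strict Implicit.
Unset Printing Implicit Defensive.

Import GRing.Theory.
Local Open Scope ring_scope.

(* Formal power series in one variable.  Series in x and y are obtained by
   iteration, as {fps {fps R}}: the outer variable is x, the inner one is y,
   and the coefficient of x^n y^r in F is F n r. *)
Record fps (R : Type) := FPS { coef_fps :> nat -> R }.

Notation "{ 'fps' R }" := (fps R) (at level 0, format "{ 'fps'  R }").

HB.instance Definition _ (R : Type) := gen_eqMixin {fps R}.
HB.instance Definition _ (R : Type) := gen_choiceMixin {fps R}.

Lemma fpsP (R : Type) (f g : {fps R}) : f =1 g -> f = g.
Proof. by case: f g => [f] [g] /= /funext ->. Qed.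

Section Zmodule.
Variable R : zmodType.
Implicit Types f g h : {fps R}.

Definition fps_zero : {fps R} := FPS (fun=> 0).
Definition fps_opp f : {fps R} := FPS (fun n => - f n).
Definition fps_add f g : {fps R} := FPS (fun n => f n + g n).

Fact fps_addA : associative fps_add.
Proof. by move=> f g h; apply: fpsP => n; apply: addrA. Qed.
Fact fps_addC : commutative fps_add.
Proof. by move=> f g; apply: fpsP => n; apply: addrC. Qed.
Fact fps_add0 : left_id fps_zero fps_add.
Proof. by move=> f; apply: fpsP => n; apply: add0r. Qed.
Fact fps_addN : left_inverse fps_zero fps_opp fps_add.
Proof. by move=> f; apply: fpsP => n; apply: addNr. Qed.

HB.instance Definition _ :=
  GRing.isZmodule.Build {fps R} fps_addA fps_addC fps_add0 fps_addN.

End Zmodule.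

Section ComRing.
Variable R : comNzRingType.
Implicit Types f g h : {fps R}.

Definition fpsC (c : R) : {fps R} := FPS (fun n => if n == 0%N then c else 0).
Definition fpsX : {fps R} := FPS (fun n => (n == 1%N)%:R).
Definition fps_mul f g : {fps R} :=
  FPS (fun n => \sum_(i < n.+1) f i * g (n - i)%N).

Let trunc N f : {poly R} := \poly_(i < N) f i.

Let coef_mulE N n (p q : {poly R}) f g :
    (forall i, (i < N)%N -> p`_i = f i) ->
    (forall i, (i < N)%N -> q`_i = g i) ->
  (n < N)%N -> fps_mul f g n = (p * q)`_n.
Proof.
move=> pf qg ltnN; rewrite coefM; apply: eq_bigr => -[i /= lein] _.
rewrite pf ?qg //; first exact: leq_ltn_trans (leq_subr _ _) ltnN.
exact: leq_trans lein ltnN.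
Qed.

Let coef_trunc N f i : (i < N)%N -> (trunc N f)`_i = f i.
Proof. by move=> ltiN; rewrite coef_poly ltiN. Qed.

Fact fps_mulA : associative fps_mul.
Proof.
move=> f g h; apply: fpsP => n.
rewrite (coef_mulE (N := n.+1) (p := trunc n.+1 f)
           (q := trunc n.+1 g * trunc n.+1 h)) //.
- rewrite (coef_mulE (N := n.+1) (p := trunc n.+1 f * trunc n.+1 g)
             (q := trunc n.+1 h)) ?mulrA //; last exact: coef_trunc.
  by move=> i lti; rewrite -(coef_mulE (N := n.+1) (f := f) (g := g)) //;
    exact: coef_trunc.
- exact: coef_trunc.
- by move=> i lti; rewrite -(coef_mulE (N := n.+1) (f := g) (g := h)) //;
    exact: coef_trunc.
Qed.

Fact fps_mulC : commutative fps_mul.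
Proof.
move=> f g; apply: fpsP => n.
rewrite (coef_mulE (coef_trunc f) (coef_trunc g) (ltnSn n)) mulrC.
by rewrite -(coef_mulE (coef_trunc g) (coef_trunc f) (ltnSn n)).
Qed.

Fact fps_mul1 : left_id (fpsC 1) fps_mul.
Proof.
move=> f; apply: fpsP => n; rewrite /= big_ord_recl /= mul1r subn0.
by rewrite big1 ?addr0 // => i _; rewrite mul0r.
Qed.

Fact fps_mulDl : left_distributive fps_mul +%R.
Proof.
move=> f g h; apply: fpsP => n /=; rewrite -big_split /=.
by apply: eq_bigr => i _; rewrite mulrDl.
Qed.

Fact fps_oner_neq0 : fpsC 1 != 0.
Proof.
apply/eqP => /(congr1 (fun f : {fps R} => f 0%N)) /= /eqP.
by rewrite oner_eq0.
Qed.

HB.instance Definition _ := GRing.Zmodule_isComNzRing.Build {fps R}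
  fps_mulA fps_mulC fps_mul1 fps_mulDl fps_oner_neq0.

Lemma fps_coef0B f g : (f - g) 0%N = f 0%N - g 0%N.
Proof. by []. Qed.

Lemma fps_coef0M f g : (f * g) 0%N = f 0%N * g 0%N.
Proof. exact: big_ord1. Qed.

Lemma fps_coef0X f j : (f ^+ j) 0%N = f 0%N ^+ j.
Proof. by elim: j => // j IHj; rewrite !exprS fps_coef0M IHj. Qed.

End ComRing.

Arguments fpsX {R}.

Section ComUnitRing.
Variable R : comUnitRingType.
Implicit Types f g : {fps R}.

Definition fps_unit : {pred {fps R}} := fun f => f 0%N \is a GRing.unit.

(* The first n coefficients of the inverse of f, obtained by solving
   \sum_(i < j.+1) g i * f (j - i) = (j == 0)%:R for g j. *)
Fixpoint fps_inv_rec f n : seq R :=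
  if n is j.+1 then
    let s := fps_inv_rec f j in
    rcons s ((f 0%N)^-1 *
             ((j == 0%N)%:R - \sum_(i < j) s`_i * f (j - i)%N))
  else [::].

Definition fps_inv f : {fps R} :=
  if fps_unit f then FPS (fun n => (fps_inv_rec f n.+1)`_n) else f.

Let size_inv_rec f n : size (fps_inv_rec f n) = n.
Proof. by elim: n => //= n IHn; rewrite size_rcons IHn. Qed.

Let nth_inv_rec f n i : (i < n)%N ->
  (fps_inv_rec f n)`_i = (fps_inv_rec f i.+1)`_i.
Proof.
elim: n => // n IHn; rewrite ltnS leq_eqVlt => /orP[/eqP -> // | ltin].
by rewrite -IHn //= nth_rcons size_inv_rec ltin.
Qed.

Fact fps_mulV : {in fps_unit, left_inverse 1 fps_inv *%R}.
Proof.
move=> f Uf; apply: fpsP => n.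
rewrite /fps_inv (Uf : fps_unit f = true) [LHS]big_ord_recr /= subnn.
rewrite nth_rcons size_inv_rec ltnn eqxx mulrAC mulVr // mul1r.
rewrite (eq_bigr (fun i : 'I_n => (fps_inv_rec f n)`_i * f (n - i)%N)).
  by rewrite addrC subrK; case: (n).
by move=> i _; rewrite (@nth_inv_rec f n i).
Qed.

Fact fps_unitPl f g : g * f = 1 -> fps_unit f.
Proof.
move=> /(congr1 (fun h : {fps R} => h 0%N)).
rewrite [LHS]big_ord1 /= => gf1.
by apply/unitrPr; exists (g 0%N); rewrite mulrC.
Qed.

Fact fps_inv_out : {in [predC fps_unit], fps_inv =1 id}.
Proof. by move=> f /negbTE nUf; rewrite /fps_inv (nUf : fps_unit f = false). Qed.

HB.instance Definition _ := GRing.ComNzRing_hasMulInverse.Build {fps R}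
  fps_mulV fps_unitPl fps_inv_out.

Lemma fps_unitE f : (f \is a GRing.unit) = (f 0%N \is a GRing.unit).
Proof. by []. Qed.

(* The denominator of the generating function is of this form. *)
Lemma fps_denom_unit (k : nat) (f g : {fps R}) : (0 < k)%N ->
  (1 - fpsX ^+ k) ^+ k - f * fpsX ^+ k * g \is a GRing.unit.
Proof.
case: k => // k _.
have x0 : (fpsX ^+ k.+1 : {fps R}) 0%N = 0 by rewrite fps_coef0X expr0n.
rewrite fps_unitE fps_coef0B !fps_coef0M x0 mulr0 mul0r subr0.
by rewrite fps_coef0X fps_coef0B x0 subr0 expr1n unitr1.
Qed.

End ComUnitRing.

Section Tilings.
Variables k m n : nat.

(* (i, j) is the cell in row i (y-coordinate) and column j (x-coordinate). *)
Definition cell : finType := ('I_m * 'I_n)%type.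

Definition htile (t : {set cell}) : bool :=
  [exists c0 : cell, (c0.2 + k <= n)%N &&
    (t == [set c : cell | (c.1 == c0.1) && (c0.2 <= c.2 < c0.2 + k)%N])].

Definition vtile (t : {set cell}) : bool :=
  [exists c0 : cell, (c0.1 + k <= m)%N &&
    (t == [set c : cell | (c.2 == c0.2) && (c0.1 <= c.1 < c0.1 + k)%N])].

Definition tiling (P : {set {set cell}}) : bool :=
  partition P [set: cell] && [forall t in P, htile t || vtile t].

(* For k = 1 horizontal and vertical tiles are the same sets of cells; this
   count is the intended one for k >= 2. *)
Definition num_tilings (r : nat) : nat :=
  #|[set P | tiling P & #|[set t in P | vtile t]| == r]|.

End Tilings.

(* \sum_(n, r >= 0) b_k(m, n, r) x^n y^r *)
Definition tiling_gf (k m : nat) : {fps {fps int}} :=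
  FPS (fun n => FPS (fun r => (num_tilings k m n r)%:R)).

(* Main.v *)
(* Count tilings by the weight y^(number of vertical tiles), removing one tile at
   a time from regions {(i, j) | f i <= j}.  As m < 2k, every vertical tile meets
   row m - k, so any row lagging behind that row can only be continued by
   horizontal tiles.  Hence, up to such forced moves, the first vertical tile at
   some column fixes its starting row a, and before the rows are flush again
   exactly k vertical tiles start in row a, interspersed with flat blocks of
   width k.  With G_q the series of the region left after q of these k tiles, this
   reads (1 - x^k) G_q = x y G_(q+1) for 0 < q < k, G_k = F, and
   (1 - x^k) F = 1 + (m - k + 1) x y G_1, which solves to the stated fraction. *)
Require Import Defs.
From mathcomp Require Import all_boot all_order all_algebra.
From mathcomp Require Import zify.

Set Implicit Arguments.
Unset Strict Implicit.
Unset Printing Implicit Defensive.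

Import GRing.Theory.
Local Open Scope ring_scope.

(** * Weighted tilings of an arbitrary set of cells *)

Section TilingWeight.
Variables (R : comNzRingType) (T : finType) (tile vert : pred {set T}) (y : R).
Implicit Types (D t : {set T}) (P Q : {set {set T}}).

Definition tiles D P := partition P D && [forall t in P, tile t].

Definition weight D : R :=
  \sum_(P | tiles D P) y ^+ #|[set t in P | vert t]|.

Lemma weight_set0 : weight set0 = 1.
Proof.
rewrite /weight (big_pred1 set0) => [|P].
  rewrite (_ : [set t in set0 | _] = set0) ?cards0 //.
  by apply/setP => t; rewrite !inE.
rewrite /tiles partition_set0 andb_idr // => /eqP->.
by apply/forall_inP => t; rewrite inE.
Qed.

Lemma tilesU1 D P t : tile t -> t != set0 -> t \subset D ->
  tiles (D :\: t) P -> tiles D (t |: P).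
Proof.
move=> tile_t t_n0 tD /andP[partP /forall_inP tileP]; apply/andP; split.
  by rewrite -(setID D t) (setIidPr tD) partitionU1 // disjoints_subset setCD subsetUr.
by apply/forall_inP => s /setU1P[-> | /tileP].
Qed.

(** Exactly one tile [t] of a tiling covers [c]; deleting it is a bijection onto the tilings of
    [D :\: t]. *)
Lemma weight_rec D c : c \in D ->
  weight D = \sum_(t | [&& tile t, c \in t & t \subset D])
               y ^+ vert t * weight (D :\: t).
Proof.
move=> cD; rewrite /weight.
rewrite (partition_big (fun P => pblock P c)
           [pred t | [&& tile t, c \in t & t \subset D]]) /=; last first.
  move=> P /andP[partP /forall_inP tileP].
  have cP : c \in cover P by rewrite (cover_partition partP).
  rewrite mem_pblock cP tileP ?pblock_mem //=.
  rewrite -(cover_partition partP); exact: bigcup_sup (pblock_mem cP).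
apply: eq_bigr => t /and3P[tile_t ct tD].
have t_n0 : t != set0 by apply/set0Pn; exists c.
rewrite big_distrr /= (reindex_onto (fun Q => t |: Q) (fun P => P :\ t)); last first.
  move=> P /andP[/andP[partP _] /eqP deft]; apply: setD1K.
  by rewrite -deft pblock_mem // (cover_partition partP).
have notinP P : tiles (D :\: t) P -> t \notin P.
  case/andP=> partP _; apply: contraL ct => tP.
  have : t \subset D :\: t by rewrite -(cover_partition partP) bigcup_sup.
  by move=> /subsetP/(_ c); rewrite inE; case: (c \in t) => // /(_ isT).
apply: eq_big => P.
  apply/idP/idP => [/andP[/andP[/andP[partP tileP] /eqP defc] /eqP defP] | tilesP].
    rewrite /tiles -defP partitionD1 ?setU11 //=.
    apply/forall_inP => s; rewrite defP => sP.
    by apply: (forall_inP tileP); rewrite setU1r.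
  have tilesP' := tilesU1 tile_t t_n0 tD tilesP.
  rewrite tilesP' setU1K ?notinP // eqxx andbT /= (def_pblock _ _ ct) ?setU11 //.
  by case/andP: tilesP' => /and3P[].
case/andP=> _ /eqP defP; rewrite -exprD; congr (_ ^+ _).
have tP : t \notin P by rewrite -defP setD11.
case vt: (vert t).
  rewrite add1n (_ : [set s in t |: P | vert s] = t |: [set s in P | vert s]).
    by rewrite cardsU1 inE (negbTE tP).
  by apply/setP => s; rewrite !inE andb_orl; case: eqP => // ->; rewrite vt.
rewrite add0n; congr #|pred_of_set _|; apply/setP => s.
by rewrite !inE andb_orl; case: eqP => // ->; rewrite vt andbF.
Qed.

End TilingWeight.

(** * Regions of the rectangle to the right of a row profile *)

Section Strip.
Variables (R : comNzRingType) (y : R) (k m n : nat).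
Hypotheses (lt_k_m : (k < m)%N) (lt_m_2k : (m < 2 * k)%N).
Implicit Types (t : {set cell m n}) (f : 'I_m -> nat).

Definition hbar (i : 'I_m) (j : nat) : {set cell m n} :=
  [set c : cell m n | (c.1 == i) && (j <= c.2 < j + k)%N].

Definition vbar (a : nat) (j : 'I_n) : {set cell m n} :=
  [set c : cell m n | (c.2 == j) && (a <= c.1 < a + k)%N].

Lemma htileP t :
  reflect (exists i j, (j + k <= n)%N /\ t = hbar i j) (htile k t).
Proof.
apply: (iffP existsP) => [[[i j] /= /andP[jk /eqP->]] | [i [j [jk ->]]]].
  by exists i, j.
have ltjn : (j < n)%N by lia.
by exists (i, Ordinal ltjn); rewrite jk eqxx.
Qed.

Lemma vtileP t :
  reflect (exists (a : 'I_(m - k + 1)) j, t = vbar a j) (vtile k t).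
Proof.
apply: (iffP existsP) => [[[i j] /= /andP[ik /eqP->]] | [a [j ->]]].
  have lta : (i < m - k + 1)%N by lia.
  by exists (Ordinal lta), j.
have ltam : (a < m)%N by have := ltn_ord a; lia.
exists (Ordinal ltam, j); rewrite eqxx andbT /=.
by have := ltn_ord a; lia.
Qed.

(** The bounds on [m] force [k >= 2], so a horizontal tile meets two columns. *)
Lemma hbar_not_vtile i j : (j + k <= n)%N -> ~~ vtile k (hbar i j).
Proof.
move=> jk; apply/negP => /vtileP[a [j' /setP eq_ht]].
have lt0 : (j < n)%N by lia.
have lt1 : (j.+1 < n)%N by lia.
have := eq_ht (i, Ordinal lt0); have := eq_ht (i, Ordinal lt1).
rewrite !inE /= eqxx -!val_eqE /=; lia.
Qed.

Lemma vbar_inj j : injective (fun a : 'I_(m - k + 1) => vbar a j).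
Proof.
move=> a b /setP eq_ab; apply/val_inj => /=.
have lta := ltn_ord a; have ltb := ltn_ord b.
have ltam : (a < m)%N by lia.
have ltbm : (b < m)%N by lia.
have := eq_ab (Ordinal ltam, j); have := eq_ab (Ordinal ltbm, j).
rewrite !inE !eqxx /=; lia.
Qed.

Definition region f : {set cell m n} := [set c : cell m n | (f c.1 <= c.2)%N].

(* A row with [n < f i] records a horizontal tile that does not fit, whence the
   value 0. *)
Definition region_weight f : R :=
  if [forall i, f i <= n]%N
  then weight (fun t => htile k t || vtile k t) (@vtile k m n) y (region f)
  else 0.

Lemma eq_region_weight f g : f =1 g -> region_weight f = region_weight g.
Proof.
move=> eq_fg; rewrite /region_weight.
have -> : region f = region g by apply/setP => c; rewrite !inE eq_fg.
by congr (if _ then _ else _); apply: eq_forallb => i; rewrite eq_fg.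
Qed.

Lemma region_weight_eq0 f i : (n < f i)%N -> region_weight f = 0.
Proof.
move=> ltnf; rewrite /region_weight; case: forallP => // /(_ i).
by rewrite leqNgt ltnf.
Qed.

(** The cell [(i, f i)] is covered either by the horizontal tile starting there or by a vertical
    tile in column [f i]. [A] selects the start rows of the vertical tiles through this cell that
    stay in the region; the last hypothesis puts all their rows level with row [i], so that what
    remains is again a [region]. *)
Lemma region_weight_rec f i (A : pred 'I_(m - k + 1)) : (f i < n)%N ->
    (forall a, A a = (a <= i < a + k)%N &&
       [forall i' : 'I_m, (a <= i' < a + k)%N ==> (f i' <= f i)%N]) ->
    (forall a (i' : 'I_m), A a -> (a <= i' < a + k)%N -> f i' = f i) ->
  region_weight f =
    region_weight (fun i' => f i' + (i' == i) * k)%N +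
    y * \sum_(a | A a) region_weight (fun i' => f i' + (a <= i' < a + k))%N.
Proof.
move=> lt_fi_n defA eq_f.
have [/forallP lefn | /forallPn[i' nle]] :=
    boolP [forall i', f i' <= n]%N; last first.
  have ltn : (n < f i')%N by rewrite ltnNge.
  rewrite (@region_weight_eq0 f i') // (@region_weight_eq0 _ i') ?ltn_addr //.
  rewrite big1 ?mulr0 ?addr0 // => a _.
  by rewrite (@region_weight_eq0 _ i') // ltn_addr.
pose j := Ordinal lt_fi_n; pose c : cell m n := (i, j).
rewrite [LHS]/region_weight ifT; last exact/forallP.
rewrite (@weight_rec _ _ _ _ _ _ c); last by rewrite inE /=.
rewrite (bigID (fun t => vtile k t)) /= addrC; congr (_ + _).
  (* If the horizontal tile overshoots column [n], the default value 0 of the new profile matches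
     the empty sum. *)
  have fits : [forall i', f i' + (i' == i) * k <= n]%N = (f i + k <= n)%N.
    apply/forallP/idP => [/(_ i) | le i']; first by rewrite eqxx mul1n.
    by case: eqP => [-> | _]; rewrite ?mul1n // addn0.
  have horiz t : [&& htile k t || vtile k t, c \in t & t \subset region f]
      && ~~ vtile k t = (f i + k <= n)%N && (t == hbar i (f i)).
    apply/idP/andP => [/andP[/and3P[/orP[/htileP | ->] // ]] | [le /eqP->]].
      move=> [i' [j' [j'k ->]]]; rewrite inE /= => /andP[/eqP<- /andP[j1 j2]].
      move=> /subsetP sub _; have ltj' : (j' < n)%N by lia.
      have := sub (i, Ordinal ltj'); rewrite !inE /= eqxx => le.
      have -> : j' = f i by lia.
      by rewrite eqxx; split=> //; lia.
    rewrite (hbar_not_vtile i le) andbT; apply/and3P; split.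
    - by apply/orP; left; apply/htileP; exists i, (f i).
    - by rewrite inE eqxx /=; lia.
    - by apply/subsetP => c'; rewrite !inE => /and3P[/eqP->].
  rewrite (eq_bigl _ _ horiz) /region_weight fits.
  case: ifP => [le | _]; last by rewrite big_pred0.
  rewrite big_pred1_eq (negbTE (hbar_not_vtile i le)) mul1r.
  congr (weight _ _ _ _); apply/setP => c'; rewrite !inE.
  by case: eqP => [-> | _]; lia.
pose bars := [set vbar a j | a : 'I_(m - k + 1) in A].
rewrite (eq_bigl (mem bars)); last first.
  move=> t; apply/idP/imsetP => [|[a]].
    case/andP=> /and3P[_ ct /subsetP sub] /vtileP[a [j' deft]].
    rewrite deft inE /= in ct; case/andP: ct => /eqP eqj cova.
    exists a; last by rewrite deft eqj.
    rewrite -[_ \in _]/(A a) defA cova; apply/forall_inP => i' covi'.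
    by have := sub (i', j'); rewrite deft !inE eqxx -eqj /= => ->.
  rewrite -[a \in _]/(A a) defA => /andP[cova /forall_inP le] ->.
  have vt : vtile k (vbar a j) by apply/vtileP; exists a, j.
  rewrite vt orbT inE eqxx cova /= andbT.
  by apply/subsetP => c'; rewrite !inE => /andP[/eqP->]; exact: le.
rewrite big_imset /=; last by move=> a b _ _; exact: vbar_inj.
rewrite mulr_sumr; apply: eq_bigr => a Aa.
have -> : vtile k (vbar a j) by apply/vtileP; exists a, j.
rewrite expr1 /region_weight ifT; last first.
  apply/forallP => i'; case cov: (_ <= _ < _)%N; last by rewrite addn0.
  by rewrite addn1 (eq_f a).
congr (_ * weight _ _ _ _); apply/setP => c'; rewrite !inE -val_eqE /=.
case cov: (a <= _ < _)%N; last by rewrite andbF addn0.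
by rewrite (eq_f _ _ Aa cov) andbT; lia.
Qed.

Fact ltn_midrow : (m - k < m)%N.
Proof. by lia. Qed.

(* Since [m < 2k], every vertical tile meets this row. *)
Definition midrow : 'I_m := Ordinal ltn_midrow.

(** A vertical tile through [(i, f i)] would contain the cell of [midrow] in column [f i], which is
    outside the region. *)
Lemma region_weight_bump f i : (f i < f midrow)%N ->
  region_weight f = region_weight (fun i' => f i' + (i' == i) * k)%N.
Proof.
move=> lt_f; have [ltn | le] := ltnP n (f midrow).
  by rewrite (@region_weight_eq0 f midrow) ?(@region_weight_eq0 _ midrow) //; lia.
rewrite (@region_weight_rec f i pred0) ?big_pred0_eq ?mulr0 ?addr0 //.
  exact: leq_trans le.
move=> a /=; apply/esym/negP => /andP[_ /forall_inP/(_ midrow)].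
by rewrite [(f midrow <= _)%N]leqNgt lt_f /=; have := ltn_ord a; lia.
Qed.

(** [midrow] never moves and each row of [s] moves once, so the rows still to be moved stay behind
    [midrow]. *)
Lemma region_weight_bumps f (s : seq 'I_m) : uniq s ->
    (forall i, i \in s -> (f i < f midrow)%N) ->
  region_weight f = region_weight (fun i => f i + (i \in s) * k)%N.
Proof.
elim: s f => [|i s IHs] f /=.
  by move=> _ _; apply: eq_region_weight => i; rewrite addn0.
case/andP=> i_s uniq_s lt_f.
have mid_s : midrow \notin i :: s by apply/negP => /lt_f; rewrite ltnn.
rewrite (region_weight_bump (lt_f i (mem_head _ _))) IHs //.
  apply: eq_region_weight => i'; rewrite inE.
  by case: eqP => [-> | _] /=; rewrite ?(negbTE i_s) ?addn0.
move: mid_s; rewrite inE => /norP[/negbTE-> _] i' si'; rewrite addn0.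
case: eqP si' i_s => [-> -> // | _ si' _].
by rewrite addn0 lt_f // inE si' orbT.
Qed.

(* The region left over when, right of column [p], [q] vertical tiles starting
   in row [a] have been placed since the last column at which all the rows were
   flush; for [q = k] the region is the rectangle from column [p] on. *)
Definition stair (a q p : nat) (i : 'I_m) : nat :=
  if (a <= i < a + k)%N then p else (p + (k - q))%N.

Lemma stair_flat a p : stair a k p =1 fun=> p.
Proof. by move=> i; rewrite /stair subnn addn0 if_same. Qed.

(** Once [midrow] has advanced to [p + k], every other row is behind it, because [0 < q], and is
    forced to advance by [k] as well. *)
Lemma stair_step a q p : (a <= m - k)%N -> (0 < q)%N ->
  region_weight (fun i => stair a q p i + (i == midrow) * k)%N =
  region_weight (stair a q (p + k)).
Proof.
move=> le_a q_gt0.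
rewrite (@region_weight_bumps _ (enum (predC1 midrow))) ?enum_uniq //.
  apply: eq_region_weight => i; rewrite mem_enum inE /= /stair.
  by case: eqP => [-> | _] /=; case: ifP => _; lia.
move=> i; rewrite mem_enum inE /= /stair eqxx => /negbTE-> /=.
by rewrite (ifT _ _ (_ : (a <= m - k < a + k)%N)); [case: ifP => _; lia | lia].
Qed.

(** As [q < k], the rows outside [a, ..., a + k - 1] begin right of column [p], so the only vertical
    tile that fits in column [p] starts in row [a]. *)
Lemma region_weight_stair a q p : (a <= m - k)%N -> (0 < q < k)%N -> (p < n)%N ->
  region_weight (stair a q p) =
    region_weight (stair a q (p + k)) + y * region_weight (stair a q.+1 p.+1).
Proof.
move=> le_a /andP[q_gt0 lt_q_k] lt_p_n.
have lta : (a < m - k + 1)%N by lia.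
have mid_p : stair a q p midrow = p by rewrite /stair ifT //=; lia.
rewrite (@region_weight_rec _ midrow (pred1 (Ordinal lta))) ?mid_p //.
- rewrite stair_step // big_pred1_eq; congr (_ + y * _).
  by apply: eq_region_weight => i; rewrite /stair /=; case: ifP => _; lia.
- move=> b; have ltb := ltn_ord b.
  apply/eqP/idP => [-> /= | /andP[_ /forall_inP le]].
    apply/andP; split; first lia.
    by apply/forall_inP => i covi; rewrite /stair covi.
  (* The first and last rows of the tile both have to lie in the band of [a], which forces
     [b = a]. *)
  have ltbm : (b < m)%N by lia.
  have ltbkm : (b + k.-1 < m)%N by lia.
  have := le (Ordinal ltbm); have := le (Ordinal ltbkm).
  rewrite /stair /= => le1 le2; apply/val_inj => /=.
  by move: le1 le2; case: ifP => ?; case: ifP => ?; lia.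
by move=> b i /eqP-> /= cov; rewrite /stair cov.
Qed.

(** After a vertical tile in column [p], the rows it misses lag one column behind [midrow] and are
    forced on to [p + k = p.+1 + (k - 1)]: the stair with [q = 1]. *)
Lemma region_weight_flat p : (p < n)%N ->
  region_weight (fun=> p) =
    region_weight (fun=> p + k)%N +
    y * \sum_(a < m - k + 1) region_weight (stair a 1 p.+1).
Proof.
move=> lt_p_n; rewrite (@region_weight_rec _ midrow predT) //.
- congr (_ + y * _).
    rewrite -(eq_region_weight (stair_flat 0 (p + k))) -stair_step //; last lia.
    by apply: eq_region_weight => i; rewrite stair_flat.
  apply: eq_bigr => a _; have lta := ltn_ord a.
  rewrite (@region_weight_bumps _
             (enum [pred i : 'I_m | ~~ (a <= i < a + k)%N])) ?enum_uniq //.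
    apply: eq_region_weight => i; rewrite mem_enum inE /= /stair.
    by case: ifP => _ /=; lia.
  by move=> i; rewrite mem_enum inE /= => /negbTE->; lia.
- move=> a; have lta := ltn_ord a; apply/esym/andP; split; first by move=> /=; lia.
  by apply/forall_inP.
Qed.

(** As [k < m], some row lies outside the band, row [k] if [a = 0] and row 0 otherwise, and it
    begins beyond column [n]. *)
Lemma region_weight_stair_eq0 a q p : (a <= m - k)%N -> (q < k)%N -> (n <= p)%N ->
  region_weight (stair a q p) = 0.
Proof.
move=> le_a lt_q_k le_n_p.
have [-> | a_gt0] := posnP a.
  have lt_km : (k < m)%N by lia.
  by rewrite (@region_weight_eq0 _ (Ordinal lt_km)) // /stair ifF /=; lia.
have lt_0m : (0 < m)%N by lia.
by rewrite (@region_weight_eq0 _ (Ordinal lt_0m)) // /stair ifF /=; lia.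
Qed.

Lemma region_weight_flat_end : region_weight (fun=> n) = 1.
Proof.
rewrite /region_weight ifT; last exact/forallP.
rewrite (_ : region _ = set0) ?weight_set0 //; apply/setP => c.
by rewrite !inE leqNgt ltn_ord.
Qed.

End Strip.

(** * Coefficients of power series *)

Section FpsCoef.
Variable R : comNzRingType.
Implicit Types f : {fps R}.

Lemma coef_fpsXM f n : (fpsX * f) n = if n is n'.+1 then f n' else 0.
Proof.
case: n => [|n]; first by rewrite fps_coef0M mul0r.
rewrite [LHS]big_ord_recl [LHS]addrC big_ord_recl /= mul0r mul1r subn1 addr0.
by rewrite big1 ?addr0 // => i _; rewrite mul0r.
Qed.

Lemma coef_fpsXnM f j n :
  (fpsX ^+ j * f) n = if (n < j)%N then 0 else f (n - j)%N.
Proof.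
elim: j n => [|j IHj] n; first by rewrite expr0 mul1r subn0.
by rewrite exprS -mulrA coef_fpsXM; case: n => // n; rewrite IHj ltnS subSS.
Qed.

Lemma coef_fpsCM (c : R) f n : (fpsC c * f) n = c * f n.
Proof.
rewrite [LHS]big_ord_recl /= subn0 big1 ?addr0 // => i _.
by rewrite mul0r.
Qed.

Lemma coef_fpsMn f (j n : nat) : (f *+ j) n = f n *+ j.
Proof. by elim: j => // j IHj; rewrite !mulrS -IHj. Qed.

Lemma coef_fps_sum (I : Type) (s : seq I) (P : pred I) (F : I -> {fps R}) n :
  (\sum_(i <- s | P i) F i) n = \sum_(i <- s | P i) F i n.
Proof. by elim/big_rec2: _ => // i c f _ <-. Qed.

Lemma coef_fpsXn j n : (fpsX ^+ j : {fps R}) n = (n == j)%:R.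
Proof.
rewrite -[fpsX ^+ j]mulr1 coef_fpsXnM [X in if _ then _ else X]/=.
by case: ltngtP => [//|ltjn|->]; rewrite ?subnn // subn_eq0 leqNgt ltjn.
Qed.

End FpsCoef.

(** At fixed [n] the series lies in [{fps int}], whose variable is [y]; its [r]-th coefficient keeps
    the tilings with [r] vertical tiles. *)
Lemma tiling_gfE k m n :
  tiling_gf k m n =
    weight (fun t => htile k t || vtile k t) (@vtile k m n) fpsX
      [set: cell m n].
Proof.
apply: fpsP => r; rewrite /weight coef_fps_sum /= /num_tilings cardsE.
rewrite -sum1_card natr_sum.
rewrite [RHS](bigID (fun P : {set {set cell m n}} =>
                       #|[set t in P | vtile k t]| == r)) /=.
rewrite [X in _ + X]big1 ?addr0 => [|P /andP[_ /negbTE neq]]; last first.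
  by rewrite coef_fpsXn eq_sym neq.
by apply: eq_big => [P // | P /andP[_ /eqP->]]; rewrite coef_fpsXn eqxx.
Qed.

(** * Fraction identities that solve the linear recurrence *)

Section UnitPowers.
Variables (A : comUnitRingType) (u z c g : A) (j : nat).
Hypothesis Uu : u \is a GRing.unit.

Lemma mulr_divX_succ : u * ((z / u) ^+ j.+1 * g) = z * ((z / u) ^+ j * g).
Proof. by rewrite exprS -2!mulrA (mulrCA z) mulVKr. Qed.

(** Applied with [u = 1 - x ^+ k], [z = x * y] and [j = k - 1]; multiplying by the denominator [d]
    reduces it to [u ^+ j.+1 = d + c * z ^+ j.+1]. *)
Lemma mulr_expr_div : u ^+ j.+1 - c * z ^+ j.+1 \is a GRing.unit ->
  let F := u ^+ j / (u ^+ j.+1 - c * z ^+ j.+1) in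
  u * F = 1 + c * (z * ((z / u) ^+ j * F)).
Proof.
set d := _ - _ => Ud /=; apply: (mulIr Ud).
rewrite mulrDl mul1r -!mulrA mulVr // mulr1 -exprS.
by rewrite exprMn -mulrA -exprMn mulVr // expr1n mulr1 -exprS subrK.
Qed.

End UnitPowers.

(** * The closed form and its match with the tiling weights *)

Section GeneratingFunction.
Variables k m : nat.
Hypotheses (lt_k_m : (k < m)%N) (lt_m_2k : (m < 2 * k)%N).

Let x : {fps {fps int}} := fpsX.
Let y : {fps {fps int}} := fpsC fpsX.

Definition rect_gf : {fps {fps int}} :=
  (1 - x ^+ k) ^+ (k - 1) /
    ((1 - x ^+ k) ^+ k - (m - k + 1)%:R * x ^+ k * y ^+ k).

(** The series [G_q], obtained by solving its recurrence downwards from [G_k]. *)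
Definition stair_gf q := (x * y / (1 - x ^+ k)) ^+ (k - q) * rect_gf.

Lemma stair_gf_full : stair_gf k = rect_gf.
Proof. by rewrite /stair_gf subnn mul1r. Qed.

Lemma fps_1BXn_unit : 1 - x ^+ k \is a GRing.unit.
Proof.
have k_gt0 : (0 < k)%N by lia.
by rewrite fps_unitE fps_coef0B fps_coef0X expr0n eqn0Ngt k_gt0 subr0 unitr1.
Qed.

Lemma stair_gf_rec q : (q < k)%N ->
  (1 - x ^+ k) * stair_gf q = x * (y * stair_gf q.+1).
Proof.
move=> lt_q_k; rewrite /stair_gf (_ : k - q = (k - q.+1).+1)%N; last by lia.
by rewrite (mulr_divX_succ _ _ _ fps_1BXn_unit) [RHS]mulrA.
Qed.

Lemma rect_gf_rec :
  (1 - x ^+ k) * rect_gf = 1 + (m - k + 1)%:R * (x * (y * stair_gf 1)).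
Proof.
have k_gt0 : (0 < k)%N by lia.
have := fps_denom_unit (m - k + 1)%:R (y ^+ k) k_gt0.
have := fps_1BXn_unit; rewrite /stair_gf /rect_gf -/x [x * (y * _)]mulrA.
rewrite -[_ * x ^+ k * _]mulrA -exprMn.
move: (x * y) (1 - x ^+ k) => z u Uu.
rewrite subn1 -[in u ^+ k](prednK k_gt0) -[in z ^+ k](prednK k_gt0).
by move=> /(mulr_expr_div Uu)->.
Qed.

Lemma stair_gf_coef q n : (q < k)%N ->
  stair_gf q n = (if (n < k)%N then 0 else stair_gf q (n - k)%N) +
                 (if n is n'.+1 then fpsX * stair_gf q.+1 n' else 0).
Proof.
move=> lt_q_k; have /eqP := stair_gf_rec lt_q_k.
rewrite mulrBl mul1r subr_eq addrC => /eqP eq_gf.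
rewrite [in LHS]eq_gf -coef_fpsXnM; congr (_ + _).
by rewrite coef_fpsXM; case: n => // n; rewrite coef_fpsCM.
Qed.

Lemma rect_gf_coef n :
  rect_gf n = (n == 0%N)%:R + (if (n < k)%N then 0 else rect_gf (n - k)%N) +
    (if n is n'.+1 then fpsX * stair_gf 1 n' else 0) *+ (m - k + 1).
Proof.
have /eqP := rect_gf_rec; rewrite mulrBl mul1r subr_eq addrAC => /eqP eq_gf.
rewrite [in LHS]eq_gf -coef_fpsXnM mulr_natl; congr (_ + _ + _).
  by case: n.
by rewrite coef_fpsMn coef_fpsXM; case: n => // n; rewrite coef_fpsCM.
Qed.

(** Strong induction on the number [d] of columns left: both sides obey the same recurrence, which
    lowers [d] by 1 or by [k]. The value does not depend on [a], so the sum over start rows becomes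
    the factor [m - k + 1]. *)
Lemma region_weight_gf n p d a q :
    (p + d = n)%N -> (a <= m - k)%N -> (0 < q <= k)%N ->
  region_weight fpsX k n (@stair k m a q p) = stair_gf q d.
Proof.
elim/ltn_ind: d => d IHd in p a q * => def_n le_a /andP[q_gt0].
have k_gt0 : (0 < k)%N by lia.
have lt_0m : (0 < m)%N by lia.
(* A shift by [k] past the right edge has weight 0, which matches the missing coefficient when
   [d < k]. *)
have jump q' : (0 < q' <= k)%N -> (0 < d)%N ->
    region_weight fpsX k n (@stair k m a q' (p + k)) =
    if (d < k)%N then 0 else stair_gf q' (d - k)%N.
  move=> q'_k d_gt0; case: ltnP => [lt_d_k | le_k_d]; last first.
    by rewrite (IHd (d - k)%N) //; lia.
  rewrite (@region_weight_eq0 _ _ _ _ _ _ (Ordinal lt_0m)) // /stair.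
  by case: ifP => _; lia.
rewrite leq_eqVlt => /predU1P[-> | lt_q_k].
  rewrite stair_gf_full rect_gf_coef (eq_region_weight _ _ _ (stair_flat _ _ _)).
  have [d0 | d_gt0] := posnP d.
    rewrite d0 k_gt0 mul0rn !addr0.
    by rewrite -def_n d0 addn0 region_weight_flat_end.
  rewrite region_weight_flat //; last by lia.
  rewrite -(eq_region_weight _ _ _ (stair_flat k a _)) jump ?k_gt0 ?leqnn //.
  rewrite stair_gf_full add0r; congr (_ + _).
  case: d IHd def_n d_gt0 {jump} => // d IHd def_n _.
  rewrite (eq_bigr (fun=> stair_gf 1 d)) => [|b _].
    by rewrite sumr_const card_ord mulrnAr.
  have ltb := ltn_ord b; by rewrite (IHd d) //; lia.
rewrite stair_gf_coef //; have [d0 | d_gt0] := posnP d.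
  by rewrite d0 k_gt0 addr0 region_weight_stair_eq0 //; lia.
rewrite region_weight_stair ?q_gt0 //; last by lia.
rewrite jump ?q_gt0 ?(ltnW lt_q_k) //; congr (_ + _).
case: d IHd def_n d_gt0 {jump} => // d IHd def_n _.
by rewrite (IHd d) //; lia.
Qed.

End GeneratingFunction.

Theorem theorem2p9 (k m : nat) (k_gt0 : (0 < k)%N)
    (lt_k_m : (k < m)%N) (lt_m_2k : (m < 2 * k)%N) :
  let x : {fps {fps int}} := fpsX in
  let y : {fps {fps int}} := fpsC fpsX in
  tiling_gf k m =
    (1 - x ^+ k) ^+ (k - 1) /
    ((1 - x ^+ k) ^+ k - (m - k + 1)%:R * x ^+ k * y ^+ k).
Proof.
move=> x y; apply: fpsP => n; rewrite tiling_gfE.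
rewrite -[RHS]/(rect_gf k m n) -(stair_gf_full k m).
(* The stair with [q = k] at column 0 is flat and its region is the whole rectangle; [a = 0] is an
   arbitrary choice. *)
have def_n : (0 + n = n)%N by [].
rewrite -(region_weight_gf lt_k_m lt_m_2k def_n (leq0n _)) ?k_gt0 ?leqnn //.
rewrite (eq_region_weight _ _ _ (stair_flat _ _ _)) /region_weight.
rewrite ifT; last exact/forallP.
by congr (weight _ _ _ _); apply/setP => c; rewrite !inE.
Qed.
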